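(* Let $F$ and $G$ be two probability distributions on $\mathbb{R}_+=[0,\infty)$, identified with their distribution functions. Assume that (1) $F$ is subexponential, and (2) $\lim_{x\to\infty} \overline G(x)/\overline F(x)=c$ for some constant $c\in(0,\infty)$. Then $$\lim_{x\to\infty} \frac{\overline{F*G}(x)}{\overline G(x)+\overline F(x)}=1 .$$
   Context: For a probability distribution function $F$ on $\mathbb{R}_+$, $\overline F(x):=1-F(x)$ denotes the complementary distribution function, and $*$ denotes convolution of distributions, $(F*G)(x)=\int_{[0,x]}G(x-y)\,dF(y)$. A probability distribution function $F$ on $(0,+\infty)$ such that $F(0+)=0$, $F(x)<1$ for all $x>0$, and $\lim_{x\to\infty}F(x)=1$ is called subexponential if $\lim_{x\to+\infty}\overline{F*F}(x)/\overline F(x)=2$. *)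

(* Defs.v *)
From HB Require Import structures.
From mathcomp Require Import all_boot all_order all_algebra.
From mathcomp Require Import all_classical all_reals all_analysis.

Set Implicit Arguments.
Unset Strict Implicit.
Unset Printing Implicit Defensive.

Import Order.TTheory GRing.Theory Num.Theory.
Import numFieldNormedType.Exports.

Local Open Scope classical_set_scope.
Local Open Scope ring_scope.

(* The identity of the Borel line, as a random variable whose law under a
   probability mu on R is mu itself. *)
Definition idRV (R : realType) : measurableTypeR R -> R := idfun.

HB.instance Definition _ (R : realType) :=
  @isMeasurableFun.Build _ _ _ _ (@idRV R) (@measurable_id _ _ setT).

(* The real-valued distribution function x |-> mu ]-oo, x]. *)
Definition distr_fun (R : realType) (mu : probability (measurableTypeR R) R)
  (x : R) : R := fine (cdf (@idRV R : {RV mu >-> R}) x).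

Definition on_nonneg (R : realType) (mu : probability (measurableTypeR R) R) :=
  mu `[0, +oo[%classic = 1%E.

Definition tail (R : realType) (H : R -> R) (x : R) : R := 1 - H x.

(* Distribution function of the convolution mu * nu of laws on [0, +oo[:
   the integral over [0, x] of nu ]-oo, x - y] in mu(dy). *)
Definition conv_fun (R : realType) (mu nu : probability (measurableTypeR R) R)
  (x : R) : R := \int[mu]_(y in `[0, x]) distr_fun nu (x - y).

Definition subexponential (R : realType)
    (mu : probability (measurableTypeR R) R) : Prop :=
  [/\ distr_fun mu x @[x --> 0^'+] --> (0 : R),
      (forall x : R, 0 < x -> distr_fun mu x < 1),
      distr_fun mu x @[x --> +oo] --> (1 : R) &
      tail (conv_fun mu mu) x / tail (distr_fun mu) x @[x --> +oo]
        --> (2 : R)].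

(* Main.v *)
(* Write J_H(x) for the integral over [0, x] of the tail of H at x - y in F(dy),
   so that the tail of F * H is the tail of F plus J_H; subexponentiality says
   that J_F is equivalent to the tail of F. Bounding J_F from below by splitting
   [0, x] at a fixed a shows that F is long-tailed: the tails at x - a and x are
   equivalent. Far out, the tail of G is c times that of F up to a factor e, so
   J_G - c J_F is at most e J_F plus a multiple of the mass F(]x - a, x]), which
   is negligible because F is long-tailed. Hence J_G is equivalent to c times
   the tail of F, and so the tail of F * G to 1 + c times it, as is the sum of
   the two tails. *)
Require Import Defs.
From mathcomp Require Import all_boot all_order all_algebra.
From mathcomp Require Import all_classical all_reals all_analysis.
From mathcomp Require Import ring lra.

Import Order.TTheory GRing.Theory Num.Theory.
Import numFieldNormedType.Exports.

Local Open Scope classical_set_scope.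
Local Open Scope ring_scope.

(** * Distribution functions, interval masses and tails *)

Section DistributionFunction.
Context {R : realType}.
Implicit Types mu nu : probability (measurableTypeR R) R.

Lemma distr_fun_ge0 mu x : 0 <= distr_fun mu x.
Proof. exact/fine_ge0/cdf_ge0. Qed.

Lemma distr_fun_le1 mu x : distr_fun mu x <= 1.
Proof.
rewrite -lee_fin /distr_fun fineK; first exact: cdf_le1.
exact: fin_num_measure.
Qed.

Lemma distr_fun_nondecreasing mu : {homo distr_fun mu : x y / x <= y}.
Proof.
move=> x y xy; rewrite /distr_fun fine_le//; try exact: fin_num_measure.
exact: cdf_nondecreasing.
Qed.

Lemma distr_fun_itv_oc mu (a b : R) : a <= b ->
  fine (mu `]a, b]%classic) = distr_fun mu b - distr_fun mu a.
Proof.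
move=> ab; apply/eqP; rewrite eq_sym subr_eq addrC; apply/eqP.
rewrite /distr_fun /cdf /distribution /pushforward !preimage_id.
rewrite -fineD; try exact: fin_num_measure.
congr fine; rewrite -measureU//.
  by rewrite -itv_bndbnd_setU// bnd_simp.
by rewrite -subset0 => t []/=; rewrite !in_itv/= => ta /andP[];
  rewrite ltNge ta.
Qed.

(** Since [mu] gives no mass to []-oo, 0[], only [[0, x]] contributes; the closed left end keeps a
    possible atom at 0. *)
Lemma distr_fun_itv_cc mu (x : R) : on_nonneg mu -> 0 <= x ->
  fine (mu `[0, x]%classic) = distr_fun mu x.
Proof.
move=> mu0 x0; rewrite /distr_fun /cdf /distribution /pushforward !preimage_id.
congr fine.
have neg : mu `]-oo, 0[%classic = 0%E.
  have -> : `]-oo, (0:R)[%classic = ~` `[0, +oo[%classic by rewrite setCitvr.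
  by rewrite probability_setC// mu0 subee.
rewrite (_ : `]-oo, x]%classic = `]-oo, 0[ `|` `[0, x]).
  rewrite measureU//; first by rewrite [X in (X + _)%E]neg add0e.
  by rewrite -subset0 => t []/=; rewrite !in_itv/= => t0 /andP[];
    rewrite leNgt t0.
by rewrite -itv_bndbnd_setU// bnd_simp.
Qed.

Lemma tail_ge0 mu x : 0 <= tail (distr_fun mu) x.
Proof. by rewrite subr_ge0 distr_fun_le1. Qed.

Lemma tail_le1 mu x : tail (distr_fun mu) x <= 1.
Proof. by rewrite gerBl distr_fun_ge0. Qed.

Lemma tail_nonincreasing mu x y : x <= y ->
  tail (distr_fun mu) y <= tail (distr_fun mu) x.
Proof. by move=> xy; rewrite lerB// distr_fun_nondecreasing. Qed.

(** As a function of [y], the tail at [x - y] is nondecreasing, hence measurable, and bounded by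
    1. *)
Lemma integrable_tail mu nu x (D : set R) :
  measurable (D : set (measurableTypeR R)) ->
  mu.-integrable D (EFin \o (fun y => tail (distr_fun nu) (x - y))).
Proof.
move=> mD; apply: measurable_bounded_integrable => //.
- by rewrite (le_lt_trans (probability_le1 _ _))// ltry.
- apply: measurable_realfun.nondecreasing_measurable => // y z yz.
  by apply: tail_nonincreasing; rewrite lerB.
- exists 1; split; rewrite ?realE ?ler01// => M M1 y _ /=.
  by rewrite ger0_norm ?tail_ge0// (le_trans (tail_le1 _ _))// ltW.
Qed.

(** * Tails of convolutions *)

Section Convolution.
Context (mu nu : probability (measurableTypeR R) R).
Hypothesis mu_nneg : on_nonneg mu.

(** This is [J_H(x)], with [mu] for F and [nu] for H: for independent X, Y of laws [mu], [nu] on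
    [[0, +oo[], the probability that X <= x < X + Y. *)
Definition tail_conv_part (x : R) : R :=
  \int[mu]_(y in `[0, x]) tail (distr_fun nu) (x - y).

Lemma tail_conv_funE (x : R) : 0 <= x ->
  tail (conv_fun mu nu) x = tail (distr_fun mu) x + tail_conv_part x.
Proof.
move=> x0; rewrite /tail_conv_part.
rewrite {1}/tail (_ : conv_fun mu nu x =
    \int[mu]_(y in `[0, x]) (1 - tail (distr_fun nu) (x - y))); last first.
  by apply: eq_Rintegral => y _; rewrite subKr.
rewrite RintegralB//; last exact: integrable_tail.
  rewrite Rintegral_cst// mul1r [X in _ - (X - _)](distr_fun_itv_cc mu)//.
  by rewrite /tail opprB addrA addrAC.
by apply: finite_measure_integrable_cst.
Qed.

Lemma Rintegral_itv_cc_split (a x : R) (h : R -> R) : 0 <= a -> a <= x ->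
  mu.-integrable (`[0, x]%classic : set (measurableTypeR R)) (EFin \o h) ->
  \int[mu]_(y in `[0, x]) h y =
  \int[mu]_(y in `[0, a]) h y + \int[mu]_(y in `]a, x]) h y.
Proof.
move=> a0 ax hi.
have E : `[0, x]%classic = `[0, a] `|` `]a, x].
  by rewrite -itv_bndbnd_setU// bnd_simp.
rewrite E Rintegral_setU// -?E//.
rewrite disj_set2E; apply/eqP.
by rewrite -subset0 => t []/=; rewrite !in_itv/= => /andP[_ ta] /andP[];
  rewrite ltNge ta.
Qed.

(** By monotonicity the integrand is at least the tail at [x] on [[0, a]] and at least the tail at
    [x - a] on []a, x]]. *)
Lemma tail_conv_part_ge (a x : R) : 0 <= a -> a <= x ->
  tail (distr_fun nu) x * distr_fun mu a +
  tail (distr_fun nu) (x - a) * (distr_fun mu x - distr_fun mu a) <=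
  tail_conv_part x.
Proof.
move=> a0 ax.
rewrite /tail_conv_part (Rintegral_itv_cc_split a)//; last exact: integrable_tail.
rewrite -distr_fun_itv_oc// -(distr_fun_itv_cc mu a)// -!Rintegral_cst//.
apply: lerD; apply: le_Rintegral => //;
  try exact: integrable_tail; try exact: finite_measure_integrable_cst;
  move=> y /=; rewrite in_itv/= => /andP[y1 y2]; apply: tail_nonincreasing.
  by rewrite gerBl.
by rewrite lerB// ltW.
Qed.

End Convolution.

(** Here the split is at [x - a]. For [y <= x - a] the argument [x - y] is at least [a], so the
    closeness hypothesis applies; on []x - a, x]] the integrand is at most [1 + c], and the mass of
    that interval is the difference of tails. *)
Lemma tail_conv_part_approx mu nu (a c e x : R) : on_nonneg mu ->
  0 <= c -> 0 <= e -> 0 <= a -> a <= x ->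
  (forall t, a <= t -> `|tail (distr_fun nu) t - c * tail (distr_fun mu) t| <=
                       e * tail (distr_fun mu) t) ->
  `|tail_conv_part mu nu x - c * tail_conv_part mu mu x| <=
  e * tail_conv_part mu mu x +
  (1 + c) * (tail (distr_fun mu) (x - a) - tail (distr_fun mu) x).
Proof.
move=> mu0 c0 e0 a0 ax close.
have iT b D : measurable (D : set (measurableTypeR R)) -> mu.-integrable D
    (EFin \o (fun y => b * tail (distr_fun mu) (x - y))).
  by move=> mD'; have := integrableZl mD' b (integrable_tail mu mu x _ mD').
pose h y := tail (distr_fun nu) (x - y) - c * tail (distr_fun mu) (x - y).
have ih D : measurable (D : set (measurableTypeR R)) ->
    mu.-integrable D (EFin \o h).
  by move=> mD'; have := integrableB mD'
    (integrable_tail mu nu x _ mD') (iT c _ mD').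
have -> : tail_conv_part mu nu x - c * tail_conv_part mu mu x =
    \int[mu]_(y in `[0, x]) h y.
  rewrite RintegralB//; [|exact: integrable_tail|exact: iT].
  by rewrite RintegralZl//; exact: integrable_tail.
have xa0 : 0 <= x - a by rewrite subr_ge0.
have xax : x - a <= x by rewrite gerBl.
rewrite (Rintegral_itv_cc_split mu (x - a))//; last exact: ih.
rewrite (le_trans (ler_normD _ _))//; apply: lerD.
  rewrite /tail_conv_part -RintegralZl//; last exact: integrable_tail.
  rewrite [leRHS](Rintegral_itv_cc_split mu (x - a))//; last exact: iT.
  (* The share of the upper bound coming from []x - a, x]] is nonnegative and is dropped. *)
  rewrite -[leLHS]addr0; apply: lerD; last first.
    by apply: Rintegral_ge0 => y _; rewrite mulr_ge0// tail_ge0.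
  rewrite (le_trans (le_normr_Rintegral _ _))//; first exact: ih.
  apply: le_Rintegral => //; [exact/integrable_norm/ih|exact: iT|].
  move=> y /=; rewrite in_itv/= => /andP[_ ya]; apply: close.
  by rewrite lerBrDl -lerBrDr.
have -> : tail (distr_fun mu) (x - a) - tail (distr_fun mu) x =
    fine (mu `]x - a, x]%classic).
  by rewrite distr_fun_itv_oc// /tail; lra.
rewrite -Rintegral_cst//.
rewrite (le_trans (le_normr_Rintegral _ _))//; first exact: ih.
apply: le_Rintegral => //; first exact/integrable_norm/ih.
  exact: finite_measure_integrable_cst.
move=> y _; rewrite /h (le_trans (ler_normB _ _))//.
rewrite normrM !ger0_norm ?tail_ge0// lerD ?tail_le1//.
by rewrite ler_piMr// tail_le1.
Qed.

End DistributionFunction.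

(** * Consequences of subexponentiality *)

Section Asymptotics.
Context {R : realType} (F : probability (measurableTypeR R) R).
Hypotheses (F_nneg : on_nonneg F) (F_subexp : subexponential F).

Lemma subexponential_tail_gt0 (x : R) : 0 < x -> 0 < tail (distr_fun F) x.
Proof. by case: F_subexp => _ F1 _ _ /F1; rewrite subr_gt0. Qed.

Lemma subexponential_tail_conv_part :
  tail_conv_part F F x / tail (distr_fun F) x @[x --> +oo] --> (1 : R).
Proof.
case: F_subexp => _ _ _ F2.
have {}F2 : tail (conv_fun F F) x / tail (distr_fun F) x - 1 @[x --> +oo] -->
    (1 : R).
  rewrite [X in _ --> X](_ : _ = 2 - 1); last by lra.
  by apply: cvgB; [by []|exact: cvg_cst].
apply: cvg_trans F2; apply: near_eq_cvg; near=> x.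
have x0 : 0 < x by near: x; apply: nbhs_pinfty_gt; rewrite num_real.
rewrite tail_conv_funE//.
by rewrite mulrDl divff ?gt_eqF ?subexponential_tail_gt0// addrAC subrr add0r.
Unshelve. all: by end_near. Qed.

(** The ratio is at least 1 by monotonicity; [tail_conv_part_ge], divided by the tail at [x] and
    solved for the ratio, bounds it above by [u], which also tends to 1. *)
Lemma subexponential_long_tailed (a : R) : 0 < a ->
  tail (distr_fun F) (x - a) / tail (distr_fun F) x @[x --> +oo] --> (1 : R).
Proof.
move=> a0; have Ta := subexponential_tail_gt0 _ a0.
have Fcvg : distr_fun F x @[x --> +oo] --> (1 : R) by case: F_subexp.
pose u x := (tail_conv_part F F x / tail (distr_fun F) x - distr_fun F a) /
            (distr_fun F x - distr_fun F a).
have u1 : u x @[x --> +oo] --> (1 : R).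
  have -> : (1 : R) = (1 - distr_fun F a) / (1 - distr_fun F a).
    by rewrite divff// gt_eqF.
  apply: cvgM; first apply: cvgB.
  - exact: subexponential_tail_conv_part.
  - exact: cvg_cst.
  apply: cvgV; first by rewrite gt_eqF.
  by apply: cvgB; [by []|exact: cvg_cst].
apply: (@squeeze_cvgr _ _ _ _ (cst 1) u) => //; last exact: cvg_cst.
(* Makes the denominator of [u] positive for large [x]: the limit 1 exceeds [distr_fun F a]. *)
have Fa : \forall x \near +oo, distr_fun F a < distr_fun F x.
  by move/cvgr_gt : Fcvg; apply; rewrite -subr_gt0.
near=> x.
have ax : a <= x by near: x; apply: nbhs_pinfty_ge; rewrite num_real.
have x0 : 0 < x by exact: lt_le_trans ax.
have Tx := subexponential_tail_gt0 _ x0.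
have Fax : 0 < distr_fun F x - distr_fun F a by rewrite subr_gt0; near: x.
rewrite /cst /u ler_pdivlMr// mul1r tail_nonincreasing ?gerBl ?(ltW a0)//=.
rewrite ler_pdivlMr// lerBrDr.
set d := distr_fun F x - distr_fun F a; set p := tail _ (x - a).
rewrite (_ : p / _ * d + _ = (tail (distr_fun F) x * distr_fun F a + p * d) /
  tail (distr_fun F) x); last by field; rewrite gt_eqF.
by rewrite ler_pM2r ?invr_gt0// tail_conv_part_ge// ltW.
Unshelve. all: by end_near. Qed.

Lemma subexponential_tail_conv_part_equiv
  (G : probability (measurableTypeR R) R) (c : R) : 0 < c ->
  tail (distr_fun G) x / tail (distr_fun F) x @[x --> +oo] --> c ->
  tail_conv_part F G x / tail (distr_fun F) x @[x --> +oo] --> c.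
Proof.
move=> c0 Gc; apply/cvgrPdist_le => /= e e0.
have e4 : 0 < e / 4 by lra.
have [a0 [_ Ga0]] : \forall t \near +oo,
    `|c - tail (distr_fun G) t / tail (distr_fun F) t| <= e / 4.
  by move/cvgrPdist_le : Gc; exact.
(* The added 1 makes [a] positive and strictly larger than [a0], as the neighbourhood of [+oo] is an
   open ray. *)
pose a := Num.max a0 0 + 1.
have a_gt0 : 0 < a by rewrite /a ltr_wpDl// le_max lexx orbT.
have a0a : a0 < a by rewrite /a ltr_pwDr// le_max lexx.
have J1 := subexponential_tail_conv_part.
have L1 := subexponential_long_tailed _ a_gt0.
(* With this tolerance, errors later multiplied by [c] or [1 + c] stay below [e / 4]. *)
have ec : 0 < e / 4 / (1 + c) by apply: divr_gt0 => //; lra.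
near=> x.
have ax : a <= x by near: x; apply: nbhs_pinfty_ge; rewrite num_real.
have x0 : 0 < x by exact: lt_le_trans ax.
have Tx := subexponential_tail_gt0 _ x0.
have J2 : `|1 - tail_conv_part F F x / tail (distr_fun F) x| <= e / 4 / (1 + c).
  by near: x; move/cvgrPdist_le : J1; exact.
have J3 : tail_conv_part F F x / tail (distr_fun F) x <= 2.
  by near: x; move/cvgr_le : J1; apply; lra.
have L2 : `|1 - tail (distr_fun F) (x - a) / tail (distr_fun F) x| <=
    e / 4 / (1 + c).
  by near: x; move/cvgrPdist_le : L1; exact.
have close t : a <= t ->
    `|tail (distr_fun G) t - c * tail (distr_fun F) t| <=
    e / 4 * tail (distr_fun F) t.
  move=> at_; have Tt : 0 < tail (distr_fun F) t.
    by apply: subexponential_tail_gt0; exact: lt_le_trans at_.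
  have := Ga0 t (lt_le_trans a0a at_).
  rewrite distrC -(ler_pM2r Tt) -{2}(gtr0_norm Tt) -normrM mulrBl.
  by rewrite divfK ?gt_eqF.
have := tail_conv_part_approx F G a c (e / 4) x F_nneg (ltW c0) (ltW e4)
  (ltW a_gt0) ax close.
have c1 : 0 < 1 + c by lra.
move: J2 J3 L2; rewrite !(ler_pdivlMr _ _ c1).
(* Everything is divided by [T]: [s] and [l] are close to 1, and [r] is to be close to [c]. *)
set T := tail (distr_fun F) x; set r := tail_conv_part F G x / T.
set s := tail_conv_part F F x / T; set l := tail _ (x - a) / T.
rewrite -(divfK (lt0r_neq0 Tx) (tail_conv_part F G x)).
rewrite -(divfK (lt0r_neq0 Tx) (tail_conv_part F F x)).
rewrite -(divfK (lt0r_neq0 Tx) (tail (distr_fun F) (x - a))) -/T -/r -/s -/l.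
move=> J2 J3 L2.
rewrite (_ : r * T - _ = (r - c * s) * T); last by ring.
rewrite (_ : e / 4 * _ + _ = (e / 4 * s + (1 + c) * (l - 1)) * T); last by ring.
rewrite normrM (gtr0_norm Tx) ler_pM2r// => H.
have cs : `|c - c * s| <= e / 4.
  rewrite -{1}[c]mulr1 -mulrBr normrM (gtr0_norm c0).
  by rewrite (le_trans _ J2)// mulrC ler_wpM2l//; lra.
have l1 : (1 + c) * (l - 1) <= e / 4.
  by rewrite (le_trans _ L2)// mulrC ler_wpM2r ?(ltW c1)// distrC ler_norm.
have s2 : e / 4 * s <= e / 4 * 2 by rewrite ler_pM2l.
(* Passing through [c * s], the errors add up to [e / 4 + (e / 2 + e / 4) = e]. *)
have := ler_normD (c - c * s) (c * s - r).
rewrite [`|c * s - r|]distrC addrA subrK => /le_trans; apply.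
lra.
Unshelve. all: by end_near. Qed.

End Asymptotics.

Theorem lemma2p4 (R : realType) (F G : probability (measurableTypeR R) R)
  (c : R) (F_on_nonneg : on_nonneg F) (G_on_nonneg : on_nonneg G)
  (F_subexp : subexponential F) (c_gt0 : 0 < c)
  (tail_equiv :
    tail (distr_fun G) x / tail (distr_fun F) x @[x --> +oo] --> c) :
  tail (conv_fun F G) x / (tail (distr_fun G) x + tail (distr_fun F) x)
    @[x --> +oo] --> (1 : R).
Proof.
have J := subexponential_tail_conv_part_equiv F F_on_nonneg F_subexp
  G c c_gt0 tail_equiv.
(* The target quotient with numerator and denominator both divided by the tail of [F]. *)
have : (1 + tail_conv_part F G x / tail (distr_fun F) x) /
    (tail (distr_fun G) x / tail (distr_fun F) x + 1) @[x --> +oo] --> (1 : R).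
  rewrite [X in _ --> X](_ : _ = (1 + c) / (c + 1)); last first.
    by rewrite addrC divff// gt_eqF// addr_gt0.
  apply: cvgM; first by apply: cvgD; [exact: cvg_cst|exact: J].
  apply: cvgV; first by rewrite gt_eqF// addr_gt0.
  by apply: cvgD; [exact: tail_equiv|exact: cvg_cst].
apply: cvg_trans; apply: near_eq_cvg; near=> x.
have x0 : 0 < x by near: x; apply: nbhs_pinfty_gt; rewrite num_real.
have Tx : 0 < tail (distr_fun F) x by exact: subexponential_tail_gt0.
have Gx := tail_ge0 G x.
rewrite tail_conv_funE//; field.
by rewrite !gt_eqF// ltr_wpDl.
Unshelve. all: by end_near. Qed.
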